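(* Let $d\in\mathbb{N}$ and $\mathsf{A}=\{1,x,\dots,x^d\}$ on $\mathbb{R}$. For Gaussian mixtures we have \[\left\lceil\frac{d+1}{3}\right\rceil\ \leq\ \mathcal{C}^M_{\mathsf{A}}\ \leq\ \left\lceil\frac{d+1}{2}\right\rceil,\] and every moment sequence $s$ coming from a (finite, positive) linear combination of Gaussian measures can be written as \[s=\sum_{i=1}^k c_i\,t_{\mathsf{A}}(x_i,\sigma)\quad\text{with}\quad k\leq\left\lceil\frac{d+1}{2}\right\rceil\quad\text{and some}\quad\sigma=\sigma(s)>0,\] with $c_i>0$ and $x_i\in\mathbb{R}$. Equivalently, every moment sequence $s$ from a Gaussian mixture has a Gaussian mixture representation with density of the form \[F(x)=\sum_{i=1}^k c_i\,e^{-\frac{(x-x_i)^2}{2\sigma^2}}\quad\text{with}\quad k\leq\left\lceil\frac{d+1}{2}\right\rceil\quad\text{and some}\quad\sigma=\sigma(s)>0.\]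
   Context: For $\xi\in\mathbb{R}$ and $\sigma>0$ let $\delta^G_{\xi,\sigma}$ be the Gaussian probability measure on $\mathbb{R}$ with Lebesgue density $\frac{1}{\sqrt{2\pi}\,\sigma}e^{-\frac{(x-\xi)^2}{2\sigma^2}}$. With $\mathsf{A}=\{1,x,\dots,x^d\}$ (so $m=d+1$), $t_{\mathsf{A}}(\xi,\sigma):=\left(\int_{\mathbb{R}} x^i\,\mathrm{d}\delta^G_{\xi,\sigma}(x)\right)_{i=0}^d\in\mathbb{R}^{d+1}$. A Gaussian mixture is a measure $\sum_{i=1}^k c_i\,\delta^G_{\xi_i,\sigma_i}$ with $c_i>0$; its moment sequence is $\sum_{i=1}^k c_i\,t_{\mathsf{A}}(\xi_i,\sigma_i)$. A Gaussian mixture representation of $s$ is a Gaussian mixture with moment sequence $s$. $\mathcal{T}_{\mathsf{A}}:=\{\sum_{i=1}^m c_i\,t_{\mathsf{A}}(\xi_i,\sigma_i)\mid c_i\geq0,\xi_i\in\mathbb{R},\sigma_i>0\}$ is the set of moment sequences of Gaussian mixtures. For $s\in\mathcal{T}_{\mathsf{A}}$, $\mathcal{C}^M_{\mathsf{A}}(s)$ is the smallest number $k$ of components in a Gaussian mixture representation of $s$, and $\mathcal{C}^M_{\mathsf{A}}:=\max_{s\in\mathcal{T}_{\mathsf{A}}}\mathcal{C}^M_{\mathsf{A}}(s)$. *)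

(* Defs.v *)
From HB Require Import structures.
From mathcomp Require Import all_boot all_order all_algebra.
From mathcomp Require Import all_classical all_reals all_analysis.
Set Implicit Arguments. Unset Strict Implicit. Unset Printing Implicit Defensive.
Import Order.TTheory GRing.Theory Num.Theory.
Import numFieldNormedType.Exports.
Local Open Scope classical_set_scope.
Local Open Scope ring_scope.

(* Gaussian mixtures on the real line and their moments of degree at most d.
   For s > 0, [normal_prob m s] is the measure with Lebesgue density
   [expR (- (x - m) ^+ 2 / (s ^+ 2 *+ 2))] divided by the square root of
   [s ^+ 2 * pi *+ 2]; its second parameter is the standard deviation.  *)

Definition gauss_moments (R : realType) (d : nat) (xi sigma : R) : 'rV[R]_d.+1 :=
  \row_(i < d.+1) \int[normal_prob xi sigma]_x (x ^+ i).

Definition gaussian_mixture (R : realType) (k : nat) (c xi sigma : 'I_k -> R) :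
    set (measurableTypeR R) -> \bar R :=
  fun A => (\sum_(i < k) (c i)%:E * normal_prob (xi i) (sigma i) A)%E.

Definition mixture_moments (R : realType) (d k : nat) (c xi sigma : 'I_k -> R) :
    'rV[R]_d.+1 :=
  \sum_(i < k) c i *: gauss_moments d (xi i) (sigma i).

(* The number of components k may be 0: the zero mixture represents s = 0. *)
Definition mixture_representation (R : realType) (d k : nat) (s : 'rV[R]_d.+1)
    (c xi sigma : 'I_k -> R) : Prop :=
  [/\ forall i, 0 < c i, forall i, 0 < sigma i & s = mixture_moments d c xi sigma].

Definition representable (R : realType) (d : nat) (s : 'rV[R]_d.+1) (k : nat) : Prop :=
  exists c xi sigma : 'I_k -> R, mixture_representation s c xi sigma.

Definition mixture_moment_cone (R : realType) (d : nat) : set 'rV[R]_d.+1 :=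
  [set s | exists c xi sigma : 'I_d.+1 -> R,
    [/\ forall i, 0 <= c i, forall i, 0 < sigma i & s = mixture_moments d c xi sigma]].
Arguments mixture_moment_cone R d : clear implicits.

Definition is_minimum (A : set nat) (k : nat) : Prop := A k /\ lbound A k.

Definition is_maximum (A : set nat) (k : nat) : Prop := A k /\ ubound A k.

(* The default value 0 is not used for s in the cone: see [mixture_numberP]. *)
Definition mixture_number (R : realType) (d : nat) (s : 'rV[R]_d.+1) : nat :=
  xget 0%N [set k | is_minimum (representable s) k].

Definition mixture_numbers (R : realType) (d : nat) : set nat :=
  [set mixture_number s | s in mixture_moment_cone R d].

(* The default value 0 is only used if [mixture_numbers R d] has no maximum. *)
Definition mixture_caratheodory_number (R : realType) (d : nat) : nat :=
  xget 0%N [set k | is_maximum (mixture_numbers R d) k].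

Definition has_lebesgue_density (R : realType)
    (mu : set (measurableTypeR R) -> \bar R) (F : R -> R) : Prop :=
  forall A, measurable A -> mu A = (\int[lebesgue_measure]_(y in A) (F y)%:E)%E.

Lemma cone_representable (R : realType) (d : nat) (s : 'rV[R]_d.+1) :
  mixture_moment_cone R d s -> exists k, representable s k.
Proof.
move=> [c [xi [sigma [c0 s0 ->]]]].
pose P := [pred i : 'I_d.+1 | c i != 0].
exists #|P|, (c \o enum_val), (xi \o enum_val), (sigma \o enum_val).
split=> [i|i|] /=; last 1 first.
- rewrite /mixture_moments (bigID P) /= [X in _ + X]big1 ?addr0.
    by rewrite (eq_bigl (fun i => i \in P))// big_enum_val.
  by move=> i /negPn/eqP ->; rewrite scale0r.
- by have := enum_valP i; rewrite inE lt_neqAle eq_sym c0 andbT.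
- exact: s0.
Qed.

Lemma mixture_numberP (R : realType) (d : nat) (s : 'rV[R]_d.+1) :
  mixture_moment_cone R d s -> is_minimum (representable s) (mixture_number s).
Proof.
move=> /cone_representable[k rk].
have ex : exists k, `[< representable s k >] by exists k; apply/asboolP.
case: (ex_minnP ex) => j /asboolP rj jmin.
have mj : is_minimum (representable s) j.
  by split=> // i ri; rewrite leEnat; apply: jmin; apply/asboolP.
rewrite /mixture_number.
by case: xgetP => [i _ //|/(_ j)/(_ mj)].
Qed.

(* Main.v *)
Require Import Defs.
From HB Require Import structures.
From mathcomp Require Import all_boot all_order all_algebra.
From mathcomp Require Import all_classical all_reals all_analysis.
From mathcomp Require Import measurable_realfun complex zify ring.
Set Implicit Arguments. Unset Strict Implicit. Unset Printing Implicit Defensive.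
Import Order.TTheory GRing.Theory Num.Theory.
Import numFieldNormedType.Exports.
Local Open Scope classical_set_scope.
Local Open Scope ring_scope.

(* Upper bound.  Removing a small common variance v from all components of a
   mixture leaves a mixture of Gaussians, so the deconvolved moment functional
   is positive definite on polynomials.  Its n-point Gauss quadrature, exact up
   to degree 2n - 1, reconvolved with N(0, v), is a mixture of n Gaussians of
   variance v with the same moments up to degree 2n - 1; take
   n = ceil((d + 1) / 2).

   Lower bound.  The d + 1 moments of a k-component mixture are polynomials in
   the 3k parameters.  If 3k < d + 1 they are algebraically dependent, whereas
   the coordinates of points of the moment cone satisfy no polynomial
   relation. *)

(** * Gaussian expectation of polynomials *)

Section GaussianExpectation.
Variable R : realType.
Implicit Types (u v xi : R) (p q : {poly R}).

(** For [u >= 0] these are the moments of a normal law of variance [u] as polynomials in its mean;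
    [u = -1] gives the probabilists' Hermite polynomials. *)
Fixpoint heat_poly u k : {poly R} :=
  if k is k'.+1 then 'X * heat_poly u k' + u *: (heat_poly u k')^`() else 1.

(** The Appell property of Hermite polynomials: differentiating the recurrence and applying
    induction to both derivative terms gives back the recurrence one level lower. *)
Lemma deriv_heat_poly u k : (heat_poly u k.+1)^`() = k.+1%:R *: heat_poly u k.
Proof.
elim: k => [|k IH]; first by rewrite /= mulr1 derivC scaler0 addr0 derivX scale1r.
rewrite [heat_poly u k.+2]/= -/(heat_poly u k.+1) derivD derivM derivX mul1r derivZ.
rewrite IH derivZ -scalerAr scalerA [u * _]mulrC -scalerA -addrA -scalerDr.
by rewrite -[k.+2%:R]natr1 scalerDl scale1r addrC.
Qed.

(* exp ((u / 2) D^2) p, which for 0 <= u is xi |-> E p(xi + sqrt u Z) with Z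
   standard normal; negative u undoes the convolution. *)
Definition heat u p : {poly R} := \sum_(i < size p) p`_i *: heat_poly u i.

Lemma heatE n u p : (size p <= n)%N -> heat u p = \sum_(i < n) p`_i *: heat_poly u i.
Proof.
move=> pn; rewrite /heat (big_ord_widen _ (fun i => p`_i *: heat_poly u i) pn).
rewrite big_mkcond; apply: eq_bigr => i _; case: ltnP => // pi.
by rewrite nth_default// scale0r.
Qed.

Lemma heat_is_linear u : linear (heat u).
Proof.
move=> a p q; pose n := maxn (size p) (size q).
rewrite (@heatE n _ p) ?leq_maxl// (@heatE n _ q) ?leq_maxr//.
rewrite (@heatE n); last first.
  rewrite (leq_trans (size_polyD _ _))// geq_max leq_maxr.
  by rewrite (leq_trans (size_scale_leq _ _)) ?leq_maxl.
rewrite scaler_sumr -big_split; apply: eq_bigr => i _ /=.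
by rewrite coefD coefZ scalerDl scalerA.
Qed.

HB.instance Definition _ u :=
  GRing.isLinear.Build R {poly R} {poly R} *:%R (heat u) (heat_is_linear u).

Lemma heatC u c : heat u c%:P = c%:P.
Proof.
rewrite (@heatE 1) ?size_polyC ?leq_b1// big_ord_recl big_ord0 addr0 coefC eqxx.
by rewrite /= alg_polyC.
Qed.

Lemma heat_Xn u k : heat u 'X^k = heat_poly u k.
Proof.
rewrite (@heatE k.+1) ?size_polyXn// big_ord_recr/= big1 ?add0r => [|i _].
  by rewrite coefXn eqxx scale1r.
by rewrite coefXn ltn_eqF// scale0r.
Qed.

Let deriv_sum n (F : 'I_n -> {poly R}) : (\sum_(i < n) F i)^`() = \sum_(i < n) (F i)^`().
Proof. exact: raddf_sum. Qed.

(** Moving X past exp((u / 2) D^2) costs the extra term u D. This is Stein's identity in polynomial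
    form and drives the inductions on [p] below. *)
Lemma heat_mulX u p : heat u ('X * p) = 'X * heat u p + u *: (heat u p)^`().
Proof.
rewrite (@heatE (size p).+1); last first.
  by rewrite (leq_trans (size_polyMleq _ _))// size_polyX.
rewrite big_ord_recl coefXM eqxx scale0r add0r /heat deriv_sum scaler_sumr mulr_sumr.
rewrite -big_split; apply: eq_bigr => i _ /=.
by rewrite coefXM/= derivZ scalerDr scalerAr !scalerA [u * _]mulrC.
Qed.

Lemma deriv_heat u p : (heat u p)^`() = heat u p^`().
Proof.
rewrite (@heatE (size p).+1 _ p)// (@heatE (size p) _ p^`()); last first.
  by apply/leq_sizeP => i pi; rewrite coef_deriv nth_default ?mul0rn ?leqW.
rewrite big_ord_recl derivD derivZ [in LHS]/= derivC scaler0 add0r deriv_sum.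
apply: eq_bigr => i _; rewrite derivZ deriv_heat_poly coef_deriv scalerA.
by rewrite mulr_natr.
Qed.

(** Semigroup law: D commutes with [heat], so both sides obey the recursion of [heat_mulX] with
    parameter [u + v]. *)
Lemma heat_heat u v p : heat u (heat v p) = heat (u + v) p.
Proof.
elim/poly_ind: p => [|p c IH]; first by rewrite !raddf0.
rewrite mulrC !raddfD/= !heatC heat_mulX; congr (_ + _).
by rewrite raddfD/= heat_mulX linearZ/= -deriv_heat IH -addrA -scalerDl -heat_mulX.
Qed.

(* For 0 <= u and p = q this writes E (p(X)^2) as a sum of squares. *)
Lemma heat_mul u N p q : (size p <= N)%N -> heat u (p * q) =
  \sum_(k < N) (u ^+ k / k`!%:R) *: (heat u p^`(k) * heat u q^`(k)).
Proof.
elim/poly_ind: p N q => [|p c IH] N q pN.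
  by rewrite mul0r raddf0 big1// => k _; rewrite linear0 raddf0 mul0r scaler0.
(* The case [p = 0] is split off because only for nonzero [p] does [p * 'X + c%:P] have size
   [size p + 1], which yields [size p < N]. *)
move: pN; have [->|p0] := eqVneq p 0.
  rewrite mul0r add0r mul_polyC linearZ/=.
  case: N => [|N].
    rewrite leqn0 size_poly_eq0 polyC_eq0 => /eqP->.
    by rewrite big_ord0 scale0r.
  move=> _; rewrite big_ord_recl big1 ?addr0 => [|k _].
    by rewrite /= expr0 fact0 divr1 scale1r heatC mul_polyC.
  by rewrite lift0 derivSn derivC linear0 raddf0 mul0r scaler0.
move=> pN; have {pN} pN : (size p < N)%N.
  by apply: leq_trans pN; rewrite -cons_poly_def size_cons_poly nil_poly (negbTE p0).
case: N pN => // N pN.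
rewrite mulrDl mul_polyC linearD linearZ/= [p * 'X]mulrC -mulrA heat_mulX.
rewrite (IH N.+1)//; last exact: ltnW.
(* Taylor coefficients of the exponential; [aS] matches the shifted sum with the term u D from
   [heat_mulX]. *)
pose a k : R := u ^+ k / k`!%:R.
have aS k : a k.+1 * k.+1%:R = u * a k.
  by rewrite /a exprS factS natrM invfM [k.+1%:R^-1 * _]mulrC !mulrA divfK ?pnatr_eq0.
have D k : ('X * p + c%:P)^`(k.+1) = 'X * p^`(k.+1) + k.+1%:R *: p^`(k).
  by rewrite mulrC derivnMXaddC addrC scaler_nat mulrC.
have a0 : a 0%N = 1 by rewrite /a expr0 fact0 divr1.
(* Leibniz rule: the k-th derivative of X p + c is X p^(k) + k p^(k-1), and c survives only for k =
   0. *)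
have -> : \sum_(k < N.+1) a k *: (heat u ('X * p + c%:P)^`(k) * heat u q^`(k)) =
    c *: heat u q +
    \sum_(k < N.+1) a k *: (heat u ('X * p^`(k)) * heat u q^`(k)) +
    \sum_(k < N.+1) (a k * k%:R) *: (heat u p^`(k.-1) * heat u q^`(k)).
  rewrite !big_ord_recl/= a0 !scale1r mulr0 scale0r add0r.
  rewrite -[RHS]addrA -[in RHS]addrA -big_split/= !addrA raddfD/= heatC mulrDl mul_polyC.
  rewrite [c *: _ + _]addrC; congr (_ + _); apply: eq_bigr => k _.
  rewrite /bump add1n !add0n -!derivnS D raddfD/= [heat u (_ *: _)]linearZ/=.
  by rewrite mulrDl scalerDr -scalerAl scalerA.
rewrite [LHS]addrC -!addrA; congr (_ + _).
rewrite [X in _ = _ + X]big_ord_recl mulr0 scale0r add0r.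
rewrite deriv_sum scaler_sumr mulr_sumr -!big_split/=.
(* This vanishing lets the reindexed sum be extended by one term, so that all sums have the same
   range. *)
have z : p^`(N) = 0.
  by apply: derivn_poly0.
have -> : \sum_(i < N) (a (bump 0 i) * (bump 0 i)%:R) *:
     (heat u p^`((bump 0 i).-1) * heat u q^`(bump 0 i)) =
   \sum_(i < N.+1) (u * a i) *: (heat u p^`(i) * heat u q^`(i.+1)).
  rewrite big_ord_recr/= z raddf0 mul0r scaler0 addr0.
  by apply: eq_bigr => i _; rewrite /bump add1n/= aS.
rewrite -big_split/=; apply: eq_bigr => k _; rewrite -/(a k); move: (a k) => b.
rewrite heat_mulX derivZ derivM !deriv_heat -!derivnS mulrDl -[(u *: _) * _]scalerAl.
by rewrite !scalerDr !scalerA -scalerAr mulrA -addrA [b * u]mulrC.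
Qed.

(* E p(X) for X normal with mean [xi] and variance (not deviation) [u]. *)
Definition gaussE xi u p : R := (heat u p).[xi].

Lemma gaussE_is_linear xi u : linear_for *%R (gaussE xi u).
Proof. by move=> a p q; rewrite /gaussE linearP hornerD hornerZ. Qed.

HB.instance Definition _ xi u :=
  GRing.isLinear.Build R {poly R} R *%R (gaussE xi u) (gaussE_is_linear xi u).

(** In [heat_mul] with q = p every term is a square with a positive weight. The last one is strictly
    positive: the derivative of order deg p is a nonzero constant, which [heat] fixes. *)
Lemma gaussE_sqr_gt0 xi u p : 0 < u -> p != 0 -> 0 < gaussE xi u (p ^+ 2).
Proof.
move=> u0 p0; rewrite /gaussE expr2 (@heat_mul _ (size p))// horner_sum.
have a_gt0 k : 0 < u ^+ k / k`!%:R.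
  by rewrite divr_gt0 ?exprn_gt0 ?ltr0n ?fact_gt0.
have : (0 < size p)%N by rewrite size_poly_gt0.
case def_n: (size p) => [//|n] _.
rewrite big_ord_recr/=; apply: ltr_wpDl.
  apply: sumr_ge0 => k _; rewrite hornerZ hornerM -expr2.
  by rewrite mulr_ge0 ?sqr_ge0// ltW.
rewrite hornerZ hornerM -expr2 mulr_gt0//.
have -> : p^`(n) = (lead_coef p *+ n`!)%:P.
  apply/polyP => i; rewrite coef_derivn coefC lead_coefE def_n/=.
  case: i => [|i]; first by rewrite addn0 ffactnn.
  by rewrite nth_default ?mul0rn// def_n addnS ltnS leq_addr.
rewrite heatC hornerC exprn_even_gt0//= mulrn_eq0 negb_or -lt0n fact_gt0.
by rewrite lead_coef_eq0.
Qed.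

Lemma gaussE_mulX xi u p : gaussE xi u ('X * p) = xi * gaussE xi u p + u * gaussE xi u p^`().
Proof. by rewrite /gaussE heat_mulX hornerD hornerM hornerX hornerZ deriv_heat. Qed.

(** Smoothing does not raise the degree, so a quadrature rule stays exact on smoothed monomials. *)
Lemma size_heat_poly u k : (size (heat_poly u k) <= k.+1)%N.
Proof.
elim: k => [|k IH]; first by rewrite size_poly1.
rewrite /= (leq_trans (size_polyD _ _))// geq_max; apply/andP; split.
  by rewrite (leq_trans (size_polyMleq _ _))// size_polyX add2n/= ltnS.
rewrite (leq_trans (size_scale_leq _ _))//.
have [->|h0] := eqVneq (heat_poly u k) 0; first by rewrite derivC size_poly0.
by rewrite ltnW// (leq_trans (lt_size_deriv h0))// leqW.
Qed.

End GaussianExpectation.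

(** * Gauss quadrature *)

Section Quadrature.
Variable R : realType.
Implicit Types (a b : R) (p q : {poly R}).
Variable L : {scalar {poly R}}.
Hypothesis Lpos : forall p, p != 0 -> 0 < L (p ^+ 2).

(** Positivity of [L] makes the Gram matrix of 1, X, ..., X^(n-1) invertible, so X^n has an
    orthogonal projection onto their span; P is the residual. *)
Lemma exists_orthogonal_poly (n : nat) : exists2 P : {poly R}, P \is monic /\ size P = n.+1 &
  forall q, (size q <= n)%N -> L (P * q) = 0.
Proof.
pose G := \matrix_(i < n, j < n) L ('X^i * 'X^j).
have rE (v : 'rV[R]_n) : rVpoly v = \sum_(i < n) v 0 i *: 'X^i.
  apply/polyP => k; rewrite coef_rVpoly coef_sum.
  case: insubP => [i _ ik|/negPf nk]; last first.
    by rewrite big1// => i _; rewrite coefZ coefXn; case: eqP => [ki|_];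
      [move: nk; rewrite ki ltn_ord | rewrite mulr0].
  rewrite (bigD1 i)//= big1 ?addr0 => [|j ji]; first by rewrite coefZ coefXn ik eqxx mulr1.
  rewrite coefZ coefXn -ik; case: eqP => [/val_inj ij|_]; last by rewrite mulr0.
  by rewrite ij eqxx in ji.
have GE (v : 'rV[R]_n) j : (v *m G) 0 j = L (rVpoly v * 'X^j).
  rewrite mxE rE mulr_suml raddf_sum; apply: eq_bigr => i _ /=.
  by rewrite mxE -scalerAl linearZ.
(* A nonzero kernel vector would be a polynomial q orthogonal to each X^j with j < n, hence to
   itself, against positivity. *)
have Gu : G \in unitmx.
  rewrite -row_free_unit -kermx_eq0; apply/eqP/row_matrixP => i; rewrite row0.
  have : row i (kermx G) *m G = 0 by rewrite -row_mul mulmx_ker row0.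
  move: (row i _) => v vG; apply/eqP; apply: contraT => v0.
  have q0 : rVpoly v != 0.
    by apply: contra v0 => /eqP vq; rewrite -[v]rVpolyK vq linear0.
  have := Lpos q0; rewrite expr2 {2}rE mulr_sumr raddf_sum big1 ?ltxx// => j _.
  by rewrite /= -scalerAr linearZ/= -GE vG mxE mulr0.
pose w := \row_j L ('X^n * 'X^j) *m invmx G.
exists ('X^n - rVpoly w).
  have sw : (size (- rVpoly w) < size ('X^n : {poly R}))%N.
    by rewrite size_polyN size_polyXn ltnS size_poly.
  by split; [rewrite monicE lead_coefDl// lead_coefXn|rewrite size_polyDl// size_polyXn].
move=> q qn; rewrite -(@poly_rV_K _ n q qn) [rVpoly (poly_rV q)]rE mulr_sumr raddf_sum.
rewrite big1// => j _ /=.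
rewrite -scalerAr linearZ/= mulrBl raddfB/= -GE mulmxKV// mxE.
by rewrite mxE subrr mulr0.
Qed.

Section Roots.
Variables (n : nat) (P : {poly R}).
Hypotheses (Pmon : P \is monic) (Psize : size P = n.+1).
Hypothesis Porth : forall q, (size q <= n)%N -> L (P * q) = 0.

(* If P = ((X - a)^2 + b^2) Q then L (P Q) = L (((X - a) Q)^2) + b^2 L (Q^2) > 0,
   against orthogonality; b = 0 excludes double roots, b <> 0 non-real ones. *)
Lemma orthogonal_no_quadratic_factor (a b : R) :
  ~~ (('X - a%:P) ^+ 2 + (b ^+ 2)%:P %| P).
Proof.
apply/negP => /dvdpP[Q PQ].
have P0 : P != 0 by rewrite monic_neq0.
have Q0 : Q != 0 by apply: contra P0 => /eqP Q0; rewrite PQ Q0 mul0r.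
have dmon : ('X - a%:P) ^+ 2 + (b ^+ 2)%:P \is monic /\
    size (('X - a%:P) ^+ 2 + (b ^+ 2)%:P) = 3%N.
  have s3 : size (('X - a%:P) ^+ 2) = 3%N by rewrite size_exp_XsubC.
  have lt : (size ((b ^+ 2)%:P : {poly R}) < size (('X - a%:P) ^+ 2)%R)%N.
    by rewrite s3 size_polyC; case: (_ != _).
  split; last by rewrite size_polyDl.
  by rewrite monicE lead_coefDl// -monicE monic_exp ?monicXsubC.
have Qn : (size Q <= n)%N.
  have := Psize; rewrite PQ size_Mmonic ?dmon.1// dmon.2 => /eqP.
  by rewrite addnS /= addn2 eqSS => /eqP <-.
have := Porth Qn.
have -> : P * Q = (('X - a%:P) * Q) ^+ 2 + (b ^+ 2) *: (Q ^+ 2).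
  by rewrite {1}PQ -mul_polyC; ring.
rewrite raddfD/= linearZ/= => LE.
have : 0 < L ((('X - a%:P) * Q) ^+ 2) by rewrite Lpos// mulf_neq0// polyXsubC_eq0.
have : 0 <= b ^+ 2 * L (Q ^+ 2) by rewrite mulr_ge0 ?sqr_ge0// ltW ?Lpos.
by move=> h1 h2; have := ltr_wpDr h1 h2; rewrite LE ltxx.
Qed.

(** P splits over the complex numbers. A non-real root a + ib, or a repeated real root a with b = 0,
    would produce the excluded factor (X - a)^2 + b^2. *)
Lemma orthogonal_split : exists rs : seq R,
  [/\ uniq rs, size rs = n & P = \prod_(r <- rs) ('X - r%:P)].
Proof.
pose PC := map_poly (real_complex R) P.
have [rs] := closed_field_poly_normal PC.
have -> : lead_coef PC = 1.
  by rewrite lead_coef_map_inj ?(monicP Pmon) ?rmorph1//; exact: fmorph_inj.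
rewrite scale1r => PE.
have realroot z : z \in rs -> z = (complex.Re z)%:C%C.
  case: z => a b zrs; suff -> : b = 0 by [].
  apply/eqP; apply: contraT => b0.
  pose d : {poly R} := ('X - a%:P) ^+ 2 + (b ^+ 2)%:P.
  have := orthogonal_no_quadratic_factor a b; rewrite -/d.
  rewrite /dvdp => /negP[]; apply/eqP.
  have szd : size d = 3%N.
    by rewrite size_polyDl ?size_exp_XsubC// size_polyC; case: (_ != _).
  (* The remainder has degree at most 1 and vanishes at a + ib. As b is nonzero, the imaginary part
     kills its slope, then the real part its constant term. *)
  set r := P %% d.
  have szr : (size r <= 2)%N by rewrite -ltnS -szd ltn_modp -size_poly_eq0 szd.
  have rE : r = r`_1 *: 'X + (r`_0)%:P.
    apply/polyP => -[|[|i]]; rewrite coefD coefZ coefX coefC/= ?mulr0 ?mulr1 ?add0r ?addr0//.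
    by rewrite nth_default// (leq_trans szr).
  have : (map_poly (real_complex R) r).[a +i* b]%C = 0.
    have : (map_poly (real_complex R) (P %/ d * d + r)).[a +i* b]%C = 0.
      rewrite -divp_eq -/PC PE; apply/eqP; rewrite -rootE root_prod_XsubC//.
    rewrite rmorphD rmorphM/= hornerD hornerM [X in _ * X + _](_ : _ = 0) ?mulr0 ?add0r//.
    rewrite rmorphD rmorphXn/= rmorphB/= map_polyX !map_polyC/= !hornerE.
    by apply/eqP; rewrite eq_complex/=; apply/andP; split; apply/eqP; ring.
  rewrite rE rmorphD/= map_polyZ map_polyX map_polyC/= !hornerE/= => /eqP.
  rewrite eq_complex/= => /andP[/eqP e1 /eqP e2].
  have r1 : r`_1 = 0.
    apply/eqP; move: e2; rewrite mul0r !addr0 => /eqP; rewrite mulf_eq0 (negbTE b0) orbF//.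
  have r0 : r`_0 = 0 by move: e1; rewrite r1 !mul0r subr0 add0r.
  by rewrite r1 r0 scale0r addr0.
pose xs := map (@complex.Re R) rs.
have PE' : P = \prod_(r <- xs) ('X - r%:P).
  apply: (@map_poly_inj _ _ (real_complex R)); rewrite -/PC PE rmorph_prod/= big_map.
  rewrite big_seq [RHS]big_seq; apply: eq_bigr => z zrs.
  by rewrite rmorphB/= map_polyX map_polyC/= -realroot.
exists xs; split=> //; last first.
  by have := Psize; rewrite PE' size_prod_XsubC => -[].
apply: count_mem_uniq => x; case: (boolP (x \in xs)) => [xxs|/count_memPn//].
have /seq.permP -> := perm_to_rem xxs; rewrite /= eqxx; congr _.+1.
apply/count_memPn/negP => xrem.
have := orthogonal_no_quadratic_factor x 0.
rewrite expr0n addr0 PE' (perm_big _ (perm_to_rem xxs))/= big_cons.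
by rewrite (perm_big _ (perm_to_rem xrem))/= big_cons mulrA -expr2 dvdp_mulr ?dvdpp.
Qed.
End Roots.

(** The nodes are the roots of the orthogonal polynomial of degree n, and the weights are the values
    of [L] on the Lagrange basis at these nodes. *)
Lemma gauss_quadrature n : exists c x : 'I_n -> R,
  (forall i, 0 < c i) /\
  forall p, (size p <= n.*2)%N -> L p = \sum_(i < n) c i * p.[x i].
Proof.
have [P [Pmon Psize] Porth] := exists_orthogonal_poly n.
have [rs [rsu rsn PE]] := orthogonal_split Pmon Psize Porth.
pose x (i : 'I_n) := rs`_i.
have xinj i j : (x i == x j) = (i == j).
  by rewrite /x nth_uniq ?rsn.
pose Q (i : 'I_n) := \prod_(j < n | j != i) ('X - (x j)%:P).
have Qx i j : j != i -> (Q i).[x j] = 0.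
  by move=> ji; rewrite /Q (bigD1 j)//= hornerM hornerXsubC subrr mul0r.
have Qi i : (Q i).[x i] != 0.
  rewrite /Q horner_prod; apply/prodf_neq0 => j ji.
  by rewrite hornerXsubC subr_eq0 xinj eq_sym.
have sQ i : (size (Q i) <= n)%N.
  have -> : Q i = \prod_(j in predC1 i) ('X - (x j)%:P) by exact: eq_bigl.
  rewrite -big_enum size_prod_XsubC -cardE cardC1 card_ord.
  by case: n i {Porth Psize rsn x xinj Q Qx Qi} => [[]|].
pose l i := (Q i).[x i]^-1 *: Q i.
have lx i j : (l i).[x j] = (j == i)%:R.
  rewrite /l hornerZ; have [->|ji] := eqVneq j i; first by rewrite mulVf.
  by rewrite [(Q i).[x j]]Qx ?mulr0.
have sl i : (size (l i) <= n)%N by rewrite (leq_trans (size_scale_leq _ _)).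
have interp p : (size p <= n)%N -> p = \sum_(i < n) p.[x i] *: l i.
  move=> pn; apply/eqP; rewrite -subr_eq0; apply: contraT => r0.
  have := max_poly_roots r0 _ rsu; rewrite rsn => H.
  have : (n < size (p - \sum_(i < n) p.[x i] *: l i)%R)%N.
    apply: H; apply/(all_nthP 0) => i0; rewrite rsn => i_n.
    rewrite -[rs`_i0]/(x (Ordinal i_n)); move: (Ordinal i_n) => {i0 i_n}i.
    rewrite rootE hornerD hornerN horner_sum (bigD1 i)//= hornerZ lx eqxx mulr1.
    by rewrite big1 ?addr0 ?subrr// => j ji; rewrite hornerZ lx eq_sym (negbTE ji) mulr0.
  rewrite ltnNge (leq_trans (size_polyD _ _))// geq_max pn size_polyN/=.
  apply: (leq_trans (size_sum _ _ _)); apply/bigmax_leqP => i _.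
  by rewrite (leq_trans (size_scale_leq _ _)).
(* Quotient and remainder by P both have size at most n. Orthogonality kills the quotient part, and
   at the nodes p agrees with the remainder, which is interpolated exactly. *)
have LE p : (size p <= n.*2)%N -> L p = \sum_(i < n) L (l i) * p.[x i].
  move=> pn; have P0 : P != 0 by rewrite monic_neq0.
  have rn : (size (p %% P)%R <= n)%N by rewrite -ltnS -Psize ltn_modp.
  have qn : (size (p %/ P)%R <= n)%N by rewrite size_divp// Psize/= leq_subLR addnn.
  have px i : p.[x i] = (p %% P).[x i].
    rewrite {1}(divp_eq p P) hornerD hornerM [P.[_]](_ : _ = 0) ?mulr0 ?add0r//.
    by apply/eqP; rewrite -rootE PE root_prod_XsubC mem_nth ?rsn.
  rewrite {1}(divp_eq p P) raddfD/= mulrC Porth// add0r {1}(interp _ rn) raddf_sum.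
  by apply: eq_bigr => i _; rewrite /= linearZ/= mulrC px.
exists (fun i => L (l i)), x; split=> // i.
have l0 : l i != 0.
  rewrite scaler_eq0 invr_eq0 negb_or Qi.
  by apply: contraNneq (Qi i) => ->; rewrite horner0.
(* The square of [l i] has degree at most 2n - 2, so the rule is exact on it and gives L (l_i^2) = L
   (l_i): the weight is positive. *)
have := Lpos l0; rewrite LE; last first.
  rewrite expr2 (leq_trans (size_polyMleq _ _))//.
  by rewrite (leq_trans (leq_pred _))// -addnn leq_add.
rewrite (bigD1 i)//= horner_exp lx eqxx expr1n mulr1 big1 ?addr0// => j ji.
by rewrite horner_exp lx (negbTE ji) expr0n mulr0.
Qed.

End Quadrature.

(** * Reduction to a common variance *)

Lemma equal_variance_quadrature (R : realType) m (c xi tau : 'I_m -> R) : (0 < m)%N ->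
  (forall i, 0 < c i) -> (forall i, 0 < tau i) ->
  forall n, exists v (w x : 'I_n -> R), [/\ 0 < v, forall i, 0 < w i &
    forall k, (k < n.*2)%N ->
    \sum_(i < m) c i * gaussE (xi i) (tau i) 'X^k =
    \sum_(i < n) w i * gaussE (x i) v 'X^k].
Proof.
move=> m0 c0 tau0 n.
(* The common variance must be positive and below every [tau i]; indeed 1/v exceeds each 1/tau_i. *)
pose v := (1 + \sum_(i < m) (tau i)^-1)^-1.
have v0 : 0 < v.
  by rewrite invr_gt0 ltr_wpDr// sumr_ge0// => i _; rewrite invr_ge0 ltW.
have vtau i : v < tau i.
  rewrite -[tau i]invrK ltf_pV2 ?posrE ?invr_gt0 -?[_ + _ > 0]invr_gt0//.
  rewrite (bigD1 i)//= addrCA ltrDl ltr_wpDr//.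
  by rewrite sumr_ge0// => j _; rewrite invr_ge0 ltW.
pose L p := \sum_(i < m) c i * gaussE (xi i) (tau i - v) p.
have L_lin : linear_for *%R L.
  move=> a p q; rewrite /L mulr_sumr -big_split; apply: eq_bigr => i _ /=.
  by rewrite linearP/= mulrDr mulrCA.
pose L_isLinear := GRing.isLinear.Build R {poly R} R *%R L L_lin.
pose L' : {scalar {poly R}} := HB.pack L L_isLinear.
have L'E p : L' p = \sum_(i < m) c i * gaussE (xi i) (tau i - v) p by [].
have Lpos p : p != 0 -> 0 < L' (p ^+ 2).
  move=> p0; rewrite L'E.
  have t_gt0 i : 0 < c i * gaussE (xi i) (tau i - v) (p ^+ 2).
    by rewrite mulr_gt0// gaussE_sqr_gt0// subr_gt0.
  (* Strict positivity of the sum comes from one summand, which exists because [0 < m]. *)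
  rewrite (bigD1 (Ordinal m0))//= ltr_pwDl// sumr_ge0// => i _; exact: ltW.
have [w [x [w0 LE]]] := gauss_quadrature Lpos n.
exists v, w, x; split=> // k kn.
(* By the semigroup law, smoothing by [v] restores the variances [tau i - v] to [tau i]. *)
transitivity (L' (heat v 'X^k)).
  rewrite L'E; apply: eq_bigr => i _; rewrite /gaussE heat_heat subrK//.
by rewrite LE// heat_Xn (leq_trans (size_heat_poly _ _)).
Qed.

(** * Moments of the normal distribution *)

Section GaussianMoments.
Variable R : realType.
Local Notation mu := (@lebesgue_measure R).
Implicit Types (xi sigma t x : R) (p q : {poly R}).

(** Both functions integrate to [normal_prob xi sigma] over every measurable set. *)
Lemma ae_eq_normal_pdf xi sigma :
  ae_eq mu setT (Radon_Nikodym_SigmaFinite.f (normal_prob xi sigma) mu)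
    (fun x => (normal_pdf xi sigma x)%:E).
Proof.
have dom := @normal_prob_dominates R xi sigma.
apply: integral_ae_eq => //.
- exact: Radon_Nikodym_SigmaFinite.f_integrable.
- by apply/measurable_EFinP; exact: measurable_normal_pdf.
- by move=> E _ mE; rewrite -Radon_Nikodym_SigmaFinite.f_integral.
Qed.

Lemma ge0_integral_normal_prob xi sigma (f : R -> \bar R) :
  measurable_fun setT f -> (forall x, 0 <= f x)%E ->
  (\int[normal_prob xi sigma]_x f x = \int[mu]_x (f x * (normal_pdf xi sigma x)%:E))%E.
Proof.
move=> mf f0; have dom := @normal_prob_dominates R xi sigma.
rewrite -(Radon_Nikodym_SigmaFinite.change_of_variables dom)//.
apply: ae_eq_integral => //.
- apply: emeasurable_funM => //.
  exact: measurable_int (Radon_Nikodym_SigmaFinite.f_integrable dom).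
- apply: emeasurable_funM => //.
  by apply/measurable_EFinP; exact: measurable_normal_pdf.
- by apply: ae_eqe_mul2l; exact: ae_eq_normal_pdf.
Qed.

(** The change of variables asks for integrability under the normal law itself, which the
    nonnegative version supplies when applied to |f|. *)
Lemma integral_normal_prob xi sigma (f : R -> R) : measurable_fun setT f ->
  mu.-integrable setT (fun x => (f x * normal_pdf xi sigma x)%:E) ->
  \int[normal_prob xi sigma]_x f x = \int[mu]_x (f x * normal_pdf xi sigma x).
Proof.
move=> mf /integrableP[_ fi]; have dom := @normal_prob_dominates R xi sigma.
have fint : (normal_prob xi sigma).-integrable setT (EFin \o f).
  apply/integrableP; split; first exact/measurable_EFinP.
  rewrite ge0_integral_normal_prob//; last first.
    by apply: measurableT_comp => //; exact/measurable_EFinP.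
  apply: le_lt_trans fi; rewrite le_eqVlt; apply/orP; left; apply/eqP.
  apply: eq_integral => x _ /=.
  by rewrite normrM EFinM (ger0_norm (normal_pdf_ge0 _ _ _)).
rewrite /Rintegral -(Radon_Nikodym_change_of_variables dom)//.
congr fine; apply: ae_eq_integral => //.
- by apply: emeasurable_funM => //; exact: measurable_int fint.
- by apply/measurable_EFinP/measurable_funM => //; exact: measurable_normal_pdf.
- under [X in ae_eq _ _ _ X]eq_fun do rewrite EFinM.
  apply: ae_eqe_mul2l.
  apply: ae_eq_trans (ae_eq_normal_pdf xi sigma).
  by apply: ae_eq_sym; exact: ae_eq_Radon_Nikodym_SigmaFinite.
Qed.

(** |x|^n / n! is a term of the exponential series at |x|, and exp |x| is one of the two
    summands. *)
Lemma normr_expn_le_expR (n : nat) x : `|x| ^+ n <= n`!%:R * (expR x + expR (- x)).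
Proof.
have e (y : R) : 0 <= y -> y ^+ n <= n`!%:R * expR y.
  move=> y0; case: n => [|n]; first by rewrite expr0 fact0 mul1r -expR0 ler_expR.
  rewrite mulrC -ler_pdivrMr ?ltr0n ?fact_gt0//.
  by apply: le_trans (expR_ge1Dxn n y0); rewrite lerDr.
apply: (le_trans (e _ (normr_ge0 x))); rewrite ler_pM2l ?ltr0n ?fact_gt0//.
by case: (ger0P x) => _; rewrite ?lerDl ?lerDr expR_ge0.
Qed.

(* Completing the square: exponential tilting shifts the mean by sigma^2 t. *)
Lemma expR_normal_pdf xi sigma t x : sigma != 0 ->
  expR (t * x) * normal_pdf xi sigma x =
  expR (t * xi + (sigma * t) ^+ 2 / 2) * normal_pdf (xi + sigma ^+ 2 * t) sigma x.
Proof.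
move=> s0; rewrite !normal_pdfE// /normal_fun.
rewrite [LHS]mulrCA [RHS]mulrCA -!expRD; congr (_ * expR _); field.
by rewrite s0.
Qed.

(** A power times the density is dominated by two normal densities with shifted means; this serves
    both integrability and decay at infinity. *)
Lemma normr_expn_normal_pdf_le xi sigma (n : nat) x : sigma != 0 ->
  `|x| ^+ n * normal_pdf xi sigma x <=
  n`!%:R * (expR (xi + sigma ^+ 2 / 2) * normal_pdf (xi + sigma ^+ 2) sigma x +
  expR (- xi + sigma ^+ 2 / 2) * normal_pdf (xi - sigma ^+ 2) sigma x).
Proof.
move=> s0; apply: le_trans (ler_wpM2r (normal_pdf_ge0 _ _ _) (normr_expn_le_expR n x)) _.
rewrite -mulrA ler_pM2l ?ltr0n ?fact_gt0// mulrDl.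
have := expR_normal_pdf xi 1 x s0; rewrite mul1r => ->.
have := expR_normal_pdf xi (-1) x s0; rewrite mulN1r => ->.
by rewrite !mulr1 mul1r mulN1r !mulrN1 sqrrN.
Qed.

Lemma integrable_expn_normal_pdf xi sigma (n : nat) : sigma != 0 ->
  mu.-integrable setT (fun x => (x ^+ n * normal_pdf xi sigma x)%:E).
Proof.
move=> s0.
pose g x := n`!%:R * (expR (xi + sigma ^+ 2 / 2) * normal_pdf (xi + sigma ^+ 2) sigma x +
  expR (- xi + sigma ^+ 2 / 2) * normal_pdf (xi - sigma ^+ 2) sigma x).
apply: (@le_integrable _ _ _ mu _ measurableT _ (fun x => (g x)%:E)).
- apply/measurable_EFinP/measurable_funM; last exact: measurable_normal_pdf.
  exact: exprn_measurable.
- move=> x _; rewrite /= lee_fin normrM normrX (ger0_norm (normal_pdf_ge0 _ _ _)).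
  by rewrite (le_trans (normr_expn_normal_pdf_le xi n x s0))// ler_norm.
- rewrite /g; under eq_fun do rewrite EFinM EFinD !EFinM.
  by apply: integrableZl => //; apply: integrableD => //; apply: integrableZl => //;
    exact: integrable_normal_pdf.
Qed.

Lemma integrable_horner_normal_pdf xi sigma p : sigma != 0 ->
  mu.-integrable setT (fun x => (p.[x] * normal_pdf xi sigma x)%:E).
Proof.
move=> s0; under eq_fun do rewrite horner_coef mulr_suml -sumEFin.
apply: integrable_sum => // i _.
under eq_fun do rewrite -mulrA EFinM.
by apply: integrableZl => //; exact: integrable_expn_normal_pdf.
Qed.

Lemma is_derive_normal_pdf xi sigma x : sigma != 0 ->
  is_derive x 1 (normal_pdf xi sigma) (- (x - xi) / sigma ^+ 2 * normal_pdf xi sigma x).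
Proof.
move=> s0; rewrite normal_pdfE//.
have -> : (fun x => normal_peak sigma * normal_fun xi sigma x) =
  normal_peak sigma \*: (expR \o (fun x => - (x - xi) ^+ 2 / (sigma ^+ 2 *+ 2))).
  by [].
apply: is_derive_eq.
by rewrite /normal_fun/= /GRing.scale/=; field.
Qed.

Lemma is_derive_horner p x : is_derive x 1 (horner p) p^`().[x].
Proof.
apply: DeriveDef; first exact: derivable_horner.
by rewrite derivE derive1E.
Qed.

(** Here s = 1 or s = -1 selects the end of the line; these are the boundary terms of the
    integration by parts. *)
Lemma cvg_horner_normal_pdf xi sigma p (s : R) : sigma != 0 -> `|s| = 1 ->
  p.[s * n%:R] * normal_pdf xi sigma (s * n%:R) @[n --> \oo] --> (0 : R).
Proof.
move=> s0 s1.
have expn_cvg (k : nat) :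
    (s * n%:R) ^+ k * normal_pdf xi sigma (s * n%:R) @[n --> \oo] --> (0 : R).
  (* One power is held in reserve: |x|^(k+1) times the density is at most M, so |x|^k times it is at
     most M / |x|. *)
  pose M := k.+1`!%:R * (expR (xi + sigma ^+ 2 / 2) * normal_peak sigma +
                          expR (- xi + sigma ^+ 2 / 2) * normal_peak sigma).
  apply/norm_cvg0P; rewrite -cvg_shiftS /=.
  apply: (@squeeze_cvgr _ _ _ _ (cst 0) (fun n => M * n.+1%:R^-1)).
  - apply: nearW => n; rewrite normr_ge0/= ler_pdivlMr ?ltr0n//.
    rewrite normrM (ger0_norm (normal_pdf_ge0 _ _ _)) mulrAC normrX.
    have {2}<- : `|s * n.+1%:R| = n.+1%:R by rewrite normrM s1 mul1r ger0_norm.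
    rewrite -exprSr (le_trans (normr_expn_normal_pdf_le _ _ _ s0))//.
    rewrite ler_pM2l ?ltr0n ?fact_gt0// lerD// ler_pM2l ?expR_gt0//;
      exact: normal_pdf_ub.
  - exact: cvg_cst.
  - rewrite -(mulr0 M); apply: cvgM; first exact: cvg_cst.
    exact: cvg_harmonic.
suff H m : \sum_(i < m) (p`_i * (s * n%:R) ^+ i * normal_pdf xi sigma (s * n%:R))
    @[n --> \oo] --> (0 : R).
  by under eq_fun do rewrite horner_coef mulr_suml; exact: H.
elim: m => [|m IH].
  by under eq_fun do rewrite big_ord0; exact: cvg_cst.
under eq_fun do rewrite big_ord_recr/= -mulrA.
have cm : p`_m * ((s * n%:R) ^+ m * normal_pdf xi sigma (s * n%:R)) @[n --> \oo]
    --> p`_m * 0.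
  by apply: cvgM; [exact: cvg_cst|exact: expn_cvg].
rewrite mulr0 in cm.
by have h := cvgD IH cm; rewrite addr0 in h; exact: h.
Qed.

(** Stein's identity for the integral: q times the density is the derivative of p times the density,
    so its integral over the line is 0. *)
Lemma integral_normal_pdf_by_parts xi sigma p : sigma != 0 ->
  \int[mu]_x ((('X - xi%:P) * p).[x] * normal_pdf xi sigma x) =
  sigma ^+ 2 * \int[mu]_x (p^`().[x] * normal_pdf xi sigma x).
Proof.
move=> s0.
pose q : {poly R} := p^`() - sigma ^- 2 *: (('X - xi%:P) * p).
pose F x := p.[x] * normal_pdf xi sigma x.
have dF x : is_derive x 1 F (q.[x] * normal_pdf xi sigma x).
  have := is_derive_horner p x; have := is_derive_normal_pdf xi x s0 => d1 d2.
  have := @is_deriveM _ _ _ _ x 1 _ _ d2 d1.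
  move=> /(is_derive_eq); apply.
  have scE (a b : R) : a *: (b : R^o) = a * b by [].
  rewrite !scE /q hornerD hornerN hornerZ hornerM hornerXsubC.
  by field.
pose f x := q.[x] * normal_pdf xi sigma x.
have cf : continuous f.
  move=> x; apply: continuousM; first exact: continuous_horner.
  exact: continuous_normal_pdf.
suff : (\int[mu]_x (f x)%:E = 0)%E.
  move=> /(congr1 fine)/=; rewrite -/(Rintegral _ _ _) /f.
  under eq_Rintegral do rewrite /q !hornerD hornerN mulrBl hornerZ -mulrA.
  rewrite RintegralB//; first last.
  - exact: (integrableZl measurableT (sigma ^- 2)
      (integrable_horner_normal_pdf xi (('X - xi%:P) * p) s0)).
  - exact: integrable_horner_normal_pdf.
  rewrite RintegralZl//; last exact: integrable_horner_normal_pdf.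
  move=> /eqP; rewrite subr_eq0 => /eqP ->.
  by rewrite mulrA divff ?mul1r// expf_neq0.
have mf : measurable_fun setT f by exact: continuous_measurable_fun.
(* The integrals over [-n, n] tend to 0 because the boundary terms do, and to the full integral by
   dominated convergence. *)
have FTC (n : nat) : (0 < n)%N ->
    (\int[mu]_(x in `[(- n%:R)%R, n%:R]) (f x)%:E = (F n%:R)%:E - (F (- n%:R))%:E)%E.
  move=> n0; apply: continuous_FTC2.
  - by rewrite gtrN ?ltr0n.
  - exact: continuous_subspaceT.
  - have cF : continuous F.
      by move=> x; apply/differentiable_continuous/derivable1_diffP; have [] := dF x.
    split.
    + by move=> x _; have [] := dF x.
    + by apply: cvg_at_right_filter; exact: cF.
    + by apply: cvg_at_left_filter; exact: cF.
  - by move=> x _; rewrite derive1E; have [] := dF x.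
have lim0 : (\int[mu]_(x in `[(- n%:R)%R, n%:R]) (f x)%:E @[n --> \oo] --> 0)%E.
  rewrite -cvg_shiftS/=; under eq_fun do rewrite FTC//.
  apply: (@cvg_trans _ ((EFin \o (fun n => F n.+1%:R - F (- n.+1%:R))) @ \oo)) => //.
  apply: cvg_EFin; first exact: nearW.
  rewrite -(subr0 0); apply: cvgB.
    have := @cvg_horner_normal_pdf xi sigma p 1 s0 (normr1 _).
    by rewrite -cvg_shiftS; under eq_fun do rewrite mul1r.
  have := @cvg_horner_normal_pdf xi sigma p (-1) s0 (normrN1 _).
  by rewrite -cvg_shiftS; under eq_fun do rewrite mulN1r.
have lim1 : (\int[mu]_(x in `[(- n%:R)%R, n%:R]) (f x)%:E @[n --> \oo] --> \int[mu]_x (f x)%:E)%E.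
  pose f_ (n : nat) := (EFin \o f) \_ `[(- n%:R)%R, n%:R].
  have [|||||_ _] := @dominated_convergence _ _ _ mu setT measurableT f_ (EFin \o f)
    (fun x => `|(f x)%:E|%E).
  - move=> n; apply/(measurable_restrictT (EFin \o f)) => //.
    by apply: measurable_funTS; exact/measurable_EFinP.
  - exact/measurable_EFinP.
  - apply: aeW => x _; apply: cvg_near_cst.
    near=> n; rewrite /f_ patchE ifT// inE/= in_itv/= -ler_norml.
    by near: n; exact: nbhs_infty_ger.
  - apply: integrable_abse; exact: integrable_horner_normal_pdf.
  - apply: aeW => x n _; rewrite /f_ patchE; case: ifPn => // _.
    by rewrite abse0.
  by under eq_fun do rewrite -integral_mkcond.
by apply: cvg_unique lim1 lim0.
Unshelve. all: by end_near. Qed.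

(** Both sides are linear, take the value 1 at the polynomial 1 and obey Stein's identity, which
    lowers the degree. *)
Lemma Rintegral_horner_normal_pdf xi sigma p : sigma != 0 ->
  \int[mu]_x (p.[x] * normal_pdf xi sigma x) = gaussE xi (sigma ^+ 2) p.
Proof.
move=> s0; pose I p := \int[mu]_x (p.[x] * normal_pdf xi sigma x).
have ip q := integrable_horner_normal_pdf xi q s0.
have ID q r : I (q + r) = I q + I r.
  rewrite /I -RintegralD//; [|exact: ip|exact: ip].
  by apply: eq_Rintegral => x _; rewrite hornerD mulrDl.
have IZ a q : I (a *: q) = a * I q.
  rewrite /I -RintegralZl//; last exact: ip.
  by apply: eq_Rintegral => x _; rewrite hornerZ mulrA.
have I1 : I 1 = 1.
  rewrite /I /Rintegral; under eq_integral do rewrite hornerC mul1r.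
  by rewrite integral_normal_pdf.
rewrite -/(I p); have [n] := ubnP (size p); elim: n p => // n IH p.
elim/poly_ind: p => [|p c _] pn.
  by rewrite raddf0 -(scale0r 1) IZ mul0r.
have [->|p0] := eqVneq p 0.
  by rewrite mul0r add0r /gaussE heatC hornerC -[c%:P]alg_polyC IZ I1 mulr1.
have {pn} pn : (size p < n)%N.
  by move: pn; rewrite -cons_poly_def size_cons_poly nil_poly (negbTE p0).
have -> : p * 'X + c%:P = ('X - xi%:P) * p + xi *: p + c *: 1.
  by rewrite alg_polyC mulrBl mul_polyC subrK mulrC.
have GB : gaussE xi (sigma ^+ 2) (('X - xi%:P) * p) = sigma ^+ 2 * gaussE xi (sigma ^+ 2) p^`().
  by rewrite mulrBl mul_polyC raddfB/= linearZ/= gaussE_mulX addrAC subrr add0r.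
rewrite !ID !IZ I1 [I (_ * p)]integral_normal_pdf_by_parts// -/(I _).
rewrite !raddfD/= !linearZ/= GB !IH//; last first.
  by rewrite (leq_trans (lt_size_deriv _))// ltnW.
by rewrite [gaussE _ _ 1]/gaussE heatC hornerC.
Qed.

Lemma gauss_momentsE d xi sigma : 0 < sigma ->
  gauss_moments d xi sigma = \row_(i < d.+1) gaussE xi (sigma ^+ 2) 'X^i.
Proof.
move=> s0; have s1 : sigma != 0 by rewrite gt_eqF.
apply/rowP => i; rewrite !mxE integral_normal_prob; last 2 first.
- exact: exprn_measurable.
- exact: integrable_expn_normal_pdf.
by rewrite -Rintegral_horner_normal_pdf//; apply: eq_Rintegral => x _; rewrite hornerXn.
Qed.

Lemma gaussian_mixture_density k (w x : 'I_k -> R) sigma : 0 < sigma ->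
  has_lebesgue_density (gaussian_mixture w x (fun=> sigma))
    (fun y => \sum_(i < k) (w i * normal_peak sigma) *
       expR (- ((y - x i) ^+ 2 / (2 * sigma ^+ 2)))).
Proof.
move=> s0 A mA; have s1 : sigma != 0 by rewrite gt_eqF.
have iA i : mu.-integrable A (fun y => (normal_pdf (x i) sigma y)%:E).
  by apply: (integrableS measurableT) => //; exact: integrable_normal_pdf.
transitivity (\int[mu]_(y in A) \sum_(i < k) ((w i)%:E * (normal_pdf (x i) sigma y)%:E))%E.
  rewrite integral_sum//; last by move=> i; apply: integrableZl.
  by apply: eq_bigr => i _; rewrite integralZl.
apply: eq_integral => y _; rewrite -sumEFin; apply: eq_bigr => i _.
rewrite -EFinM normal_pdfE// mulrA; congr (_ * expR _)%:E.
by rewrite mulNr mulr_natl.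
Qed.

End GaussianMoments.

(** * Upper bound *)

Section UpperBound.
Variables (R : realType) (d : nat).

Lemma mixture_moments_ord0 (c xi sigma : 'I_0 -> R) : mixture_moments d c xi sigma = 0.
Proof. exact: big_ord0. Qed.

Lemma mixture_momentsE m (c xi sigma : 'I_m -> R) k : (forall i, 0 < sigma i) ->
  mixture_moments d c xi sigma 0 k =
  \sum_(i < m) c i * gaussE (xi i) (sigma i ^+ 2) 'X^k.
Proof.
move=> s0; rewrite /mixture_moments summxE; apply: eq_bigr => i _.
by rewrite gauss_momentsE// !mxE.
Qed.

Lemma equal_variance_representation (s : 'rV[R]_d.+1) m : representable s m ->
  exists k sigma (w x : 'I_k -> R),
    [/\ (k <= uphalf d.+1)%N, 0 < sigma & mixture_representation s w x (fun=> sigma)].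
Proof.
move=> [c [xi [sigma [c0 s0 ->]]]].
(* The empty mixture is treated apart, since the quadrature asks for at least one component; it
   represents s = 0. *)
have [m0|m_gt0] := posnP m.
  subst m; exists 0%N, 1, c, xi; split; [by []|exact: ltr01|split].
  - by case.
  - by move=> _; exact: ltr01.
  - by rewrite !mixture_moments_ord0.
have [|v [w [x [v0 w0 momE]]]] := @equal_variance_quadrature _ _ c xi (fun i => sigma i ^+ 2)
  m_gt0 c0 _ (uphalf d.+1).
  by move=> i; rewrite exprn_gt0.
have sv0 : 0 < Num.sqrt v by rewrite sqrtr_gt0.
exists (uphalf d.+1), (Num.sqrt v), w, x; split; [by []|exact: sv0|split].
- exact: w0.
- by move=> _; exact: sv0.
apply/rowP => k; rewrite !mixture_momentsE//.
rewrite momE; first by apply: eq_bigr => i _; rewrite sqr_sqrtr// ltW.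
(* [uphalf d.+1] is ceil((d + 1) / 2), so its double exceeds the top index d. *)
by rewrite (leq_trans (ltn_ord k))//; lia.
Qed.

Lemma le_ceil_half k : (k <= uphalf d.+1)%N -> k%:Z <= Num.ceil (d.+1%:R / 2 : R).
Proof.
case: k => [|k] kd; first by rewrite ceil_ge0 (lt_le_trans (ltrN10 R))// divr_ge0 ?ler0n.
(* k + 1 <= ceil y means k < y, which turns the claim into 2k < d + 1. *)
rewrite -addn1 PoszD lezD1 ceil_gt_int ltr_pdivlMr ?ltr0n// -pmulrn -natrM ltr_nat.
lia.
Qed.

Lemma representable_card_bound (s : 'rV[R]_d.+1) m : representable s m ->
  exists2 k, (k <= uphalf d.+1)%N & representable s k.
Proof.
move=> /equal_variance_representation[k [sigma [w [x [kd s0 rep]]]]].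
by exists k => //; exists w, x, (fun=> sigma).
Qed.

Lemma mixture_number_le (s : 'rV[R]_d.+1) :
  mixture_moment_cone R d s -> (mixture_number s <= uphalf d.+1)%N.
Proof.
move=> sc; have [/representable_card_bound[k kd rk] smin] := mixture_numberP sc.
by apply: leq_trans kd; rewrite -leEnat; exact: smin.
Qed.

(** The set contains the number of s = 0 and is bounded by the upper bound, so its maximum exists
    and the default of [xget] is not reached. *)
Lemma mixture_caratheodory_numberP :
  is_maximum (mixture_numbers R d) (mixture_caratheodory_number R d).
Proof.
have ub k : mixture_numbers R d k -> (k <= uphalf d.+1)%N.
  by move=> [s sc <-]; exact: mixture_number_le.
have ex : exists k, `[< mixture_numbers R d k >].
  exists (mixture_number (0 : 'rV[R]_d.+1)); apply/asboolP; exists 0 => //.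
  exists (fun=> 0), (fun=> 0), (fun=> 1); split=> [//|_|]; first exact: ltr01.
  by rewrite /mixture_moments big1// => i _; rewrite scale0r.
have ub' k : `[< mixture_numbers R d k >] -> (k <= uphalf d.+1)%N.
  by move=> /asboolP; exact: ub.
case: (ex_maxnP ex ub') => k /asboolP kA kmax.
have mk : is_maximum (mixture_numbers R d) k.
  by split=> // i iA; rewrite leEnat; apply: kmax; apply/asboolP.
rewrite /mixture_caratheodory_number.
by case: xgetP => [i _ //|/(_ k)/(_ mk)].
Qed.

End UpperBound.

(** * Lower bound *)

Section BoxPolynomials.
Variables (R : comNzRingType) (I : finType).
Implicit Types (f g : (I -> R) -> R) (x : I -> R).

(* Degree at most [n] in each variable, so that there are (n + 1) ^ #|I| monomials. *)
Definition boxpoly n f := exists c : {ffun I -> 'I_n.+1} -> R,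
  forall x, f x = \sum_a c a * \prod_i x i ^+ a i.

Lemma eq_boxpoly n f g : f =1 g -> boxpoly n f -> boxpoly n g.
Proof. by move=> fg [c fE]; exists c => x; rewrite -fg. Qed.

Lemma boxpoly_monomial n (a0 : {ffun I -> 'I_n.+1}) (r : R) :
  boxpoly n (fun x => r * \prod_i x i ^+ a0 i).
Proof.
exists (fun a => if a == a0 then r else 0) => x.
rewrite (bigD1 a0)//= eqxx [X in _ + X]big1 ?addr0// => a /negPf ->.
by rewrite mul0r.
Qed.

Lemma boxpoly_cst n r : boxpoly n (fun=> r).
Proof.
apply: eq_boxpoly (boxpoly_monomial [ffun=> ord0] r) => x.
by rewrite big1 ?mulr1// => i _; rewrite ffunE expr0.
Qed.

Lemma boxpoly_var i : boxpoly 1 (fun x => x i).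
Proof.
apply: eq_boxpoly (boxpoly_monomial [ffun j => inord (j == i)] 1) => x.
rewrite (bigD1 i)//= ffunE eqxx inordK// mul1r big1 ?mulr1// => j ji.
by rewrite ffunE (negPf ji) inordK.
Qed.

Lemma boxpolyD n f g : boxpoly n f -> boxpoly n g -> boxpoly n (fun x => f x + g x).
Proof.
move=> [c fE] [e gE]; exists (fun a => c a + e a) => x.
by rewrite fE gE -big_split; apply: eq_bigr => a _; rewrite mulrDl.
Qed.

Lemma boxpolyM n m f g :
  boxpoly n f -> boxpoly m g -> boxpoly (n + m) (fun x => f x * g x).
Proof.
move=> [c fE] [e gE].
(* Exponent vectors add coordinatewise and stay at most n + m, so [inord] does not truncate; the
   coefficients are convolved. *)
pose add (a : {ffun I -> 'I_n.+1} * {ffun I -> 'I_m.+1}) : {ffun I -> 'I_(n + m).+1} :=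
  [ffun i => inord (a.1 i + a.2 i)].
exists (fun s => \sum_(a | add a == s) c a.1 * e a.2) => x.
rewrite fE gE big_distrlr/= pair_bigA/= (partition_big add xpredT)//=.
apply: eq_bigr => s _; rewrite mulr_suml; apply: eq_bigr => a /eqP <-.
rewrite mulrACA -big_split; congr (_ * _); apply: eq_bigr => i _ /=.
by rewrite ffunE inordK ?exprD// ltnS leq_add// -ltnS.
Qed.

Lemma boxpolyW n m f : (n <= m)%N -> boxpoly n f -> boxpoly m f.
Proof.
move=> /subnKC <- pf; apply: eq_boxpoly (boxpolyM pf (boxpoly_cst (m - n) 1)) => x.
by rewrite mulr1.
Qed.

Lemma boxpolyX n k f : boxpoly n f -> boxpoly (k * n) (fun x => f x ^+ k).
Proof.
move=> pf; elim: k => [|k IH].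
  by apply: eq_boxpoly (boxpoly_cst 0 1) => x; rewrite expr0.
by rewrite mulSn; apply: eq_boxpoly (boxpolyM pf IH) => x; rewrite exprS.
Qed.

Lemma boxpoly_prod (J : Type) (r : seq J) (n : J -> nat) (F : J -> (I -> R) -> R) :
  (forall j, boxpoly (n j) (F j)) ->
  boxpoly (\sum_(j <- r) n j) (fun x => \prod_(j <- r) F j x).
Proof.
move=> pF; elim: r => [|j r IH].
  by rewrite big_nil; apply: eq_boxpoly (boxpoly_cst 0 1) => x; rewrite big_nil.
by rewrite big_cons; apply: eq_boxpoly (boxpolyM (pF j) IH) => x; rewrite big_cons.
Qed.

Definition polyfun f := exists n, boxpoly n f.

Lemma eq_polyfun f g : f =1 g -> polyfun f -> polyfun g.
Proof. by move=> fg [n pf]; exists n; exact: eq_boxpoly pf. Qed.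

Lemma polyfun_cst r : polyfun (fun=> r).
Proof. by exists 0%N; exact: boxpoly_cst. Qed.

Lemma polyfun_var i : polyfun (fun x => x i).
Proof. by exists 1%N; exact: boxpoly_var. Qed.

Lemma polyfunD f g : polyfun f -> polyfun g -> polyfun (fun x => f x + g x).
Proof.
move=> [n pf] [m pg]; exists (maxn n m); apply: boxpolyD.
  by apply: boxpolyW pf; exact: leq_maxl.
by apply: boxpolyW pg; exact: leq_maxr.
Qed.

Lemma polyfunM f g : polyfun f -> polyfun g -> polyfun (fun x => f x * g x).
Proof. by move=> [n pf] [m pg]; exists (n + m)%N; exact: boxpolyM. Qed.

Lemma polyfun_sum (J : Type) (r : seq J) (F : J -> (I -> R) -> R) :
  (forall j, polyfun (F j)) -> polyfun (fun x => \sum_(j <- r) F j x).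
Proof.
move=> pF; elim: r => [|j r IH].
  by apply: eq_polyfun (polyfun_cst 0) => x; rewrite big_nil.
by apply: eq_polyfun (polyfunD (pF j) IH) => x; rewrite big_cons.
Qed.

End BoxPolynomials.

(* More products of powers of the [f j] than monomials they expand into:
   (N + 1) ^ m of the former against at most (m D N + 1) ^ #|I| of the latter. *)
Lemma polyfun_algebraic_dependence (F : fieldType) (I : finType) m
    (f : 'I_m -> (I -> F) -> F) : (#|I| < m)%N -> (forall j, polyfun (f j)) ->
  exists N (c : {ffun 'I_m -> 'I_N.+1} -> F), (exists a, c a != 0) /\
    forall x, \sum_a c a * \prod_j f j x ^+ a j = 0.
Proof.
move=> Im /fin_all_exists[D0 pf].
pose D := (\sum_j D0 j)%N.
have {pf} pf j : boxpoly D (f j).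
  by apply: boxpolyW (pf j); rewrite /D (bigD1 j)//= leq_addr.
(* This N gives (E + 1)^|I| (N + 1)^|I| = N (N + 1)^|I| < (N + 1)^(|I| + 1) <= (N + 1)^m. *)
pose E := (m * D)%N; pose N := (E.+1 ^ #|I|)%N; exists N.
have /fin_all_exists[b bE] (a : {ffun 'I_m -> 'I_N.+1}) :
    boxpoly (E * N) (fun x => \prod_j f j x ^+ a j).
  have h := boxpoly_prod (index_enum 'I_m) (fun j => boxpolyX (a j) (pf j)).
  apply: boxpolyW h; rewrite -big_distrl/= /E mulnAC leq_mul2r; apply/orP; right.
  rewrite -[X in (_ <= X * _)%N]card_ord -sum_nat_const; apply: leq_sum => j _.
  by rewrite -ltnS.
pose A := {ffun 'I_m -> 'I_N.+1}; pose B := {ffun I -> 'I_(E * N).+1}.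
(* Row a holds the monomial coefficients of the product with exponents a. With more rows than
   columns, a nonzero left kernel vector exists and gives the relation. *)
pose M := \matrix_(i < #|A|, j < #|B|) b (enum_val i) (enum_val j).
have BA : (#|B| < #|A|)%N.
  rewrite !card_ffun !card_ord.
  apply: (@leq_ltn_trans ((E.+1 * N.+1) ^ #|I|)).
    have [->//|I0] := posnP #|I|; rewrite leq_exp2r//.
    by rewrite mulSn mulnS addnA ltnS leq_addl.
  rewrite expnMn -/N; apply: (@leq_trans (N.+1 ^ #|I|.+1)); last by rewrite leq_pexp2l.
  by rewrite expnS ltn_pmul2r// expn_gt0.
have : kermx M != 0.
  rewrite kermx_eq0 /row_free; apply: contraTneq BA => rM.
  by rewrite -leqNgt -rM rank_leq_col.
case/rowV0Pn => v /sub_kermxP vM v0.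
exists (fun a => v 0 (enum_rank a)); split.
  by have /rV0Pn[i vi] := v0; exists (enum_val i); rewrite enum_valK.
move=> x.
transitivity (\sum_(e : B) (\sum_(a : A) v 0 (enum_rank a) * b a e) * \prod_i x i ^+ e i).
  under eq_bigr do rewrite bE mulr_sumr.
  rewrite exchange_big/=; apply: eq_bigr => e _; rewrite mulr_suml.
  by apply: eq_bigr => a _; rewrite mulrA.
apply: big1 => e _; rewrite [X in X * _](_ : _ = (v *m M) 0 (enum_rank e)).
  by rewrite vM mxE mul0r.
rewrite mxE (reindex (@enum_rank A))/=; last by apply: onW_bij; exact: enum_rank_bij.
by apply: eq_bigr => a _; rewrite mxE !enum_rankK.
Qed.

(** Reduction modulo B isolates the lowest digit; the others follow by induction after cancelling a
    factor B. *)
Lemma digits_inj B m (a b : 'I_m -> nat) :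
  (forall j, a j < B)%N -> (forall j, b j < B)%N ->
  (\sum_(j < m) a j * B ^ j = \sum_(j < m) b j * B ^ j)%N -> a =1 b.
Proof.
elim: m a b => [|m IH] a b aB bB; first by move=> _ [].
rewrite !big_ord_recl/= !expn0 !muln1.
have split_sum (c : 'I_m.+1 -> nat) : (\sum_(i < m) c (lift ord0 i) * B ^ bump 0 i =
    (\sum_(i < m) c (lift ord0 i) * B ^ i) * B)%N.
  by rewrite big_distrl; apply: eq_bigr => i _ /=; rewrite /bump add1n expnSr mulnA.
rewrite !split_sum => E.
have ab0 : a ord0 = b ord0.
  by have := congr1 (modn^~ B) E; rewrite ![(_ + _ * B)%N]addnC !modnMDl !modn_small.
have B0 : (0 < B)%N by apply: leq_ltn_trans (aB ord0).
move: E; rewrite ab0 => /addnI/eqP; rewrite eqn_pmul2r// => /eqP E j.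
case: (unliftP ord0 j) => [i ->|->//].
by apply: (IH (a \o lift ord0) (b \o lift ord0)) => // k /=.
Qed.

(* Kronecker substitution: distinct exponent vectors become distinct powers of y. *)
Lemma kronecker_curve_independent (R : numDomainType) m N (c : {ffun 'I_m -> 'I_N.+1} -> R) :
  (forall y : R, 0 <= y -> \sum_a c a * \prod_(j < m) (y ^+ (N.+1 ^ j)) ^+ a j = 0) ->
  forall a, c a = 0.
Proof.
move=> c0 a0; pose e (a : {ffun 'I_m -> 'I_N.+1}) := (\sum_(j < m) a j * N.+1 ^ j)%N.
pose p : {poly R} := \sum_a c a *: 'X^(e a).
have pE y : p.[y] = \sum_a c a * \prod_(j < m) (y ^+ (N.+1 ^ j)) ^+ a j.
  rewrite horner_sum; apply: eq_bigr => a _; rewrite hornerZ hornerXn /e expr_sum.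
  by congr (_ * _); apply: eq_bigr => j _; rewrite -exprM mulnC.
(* p vanishes at 0, 1, ..., size p - 1, more points than a nonzero polynomial of that size
   allows. *)
have p0 : p = 0.
  apply/eqP; apply: contraT => p0.
  have u : uniq [seq i%:R : R | i <- iota 0 (size p)].
    by rewrite map_inj_uniq ?iota_uniq// => i j /eqP; rewrite eqr_nat => /eqP.
  have := max_poly_roots p0 _ u; rewrite size_map size_iota ltnn => -> //.
  by apply/allP => _ /mapP[i _ ->]; rewrite rootE pE c0 ?ler0n.
(* By uniqueness of digits, no other exponent vector contributes to this coefficient. *)
have := coef0 R (e a0); rewrite -p0 coef_sum (bigD1 a0)//= coefZ coefXn eqxx mulr1.
rewrite big1 ?addr0// => a aa0; rewrite coefZ coefXn.
case: eqP => [ea|_]; last by rewrite mulr0.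
case/eqP: aa0; apply/ffunP => j; apply: val_inj.
symmetry; apply: (@digits_inj N.+1 m (fun i => a0 i) (fun i => a i) _ _ ea j) => i;
  exact: ltn_ord.
Qed.

(** * Gaussian moments as polynomials in the parameters *)

Section LowerBound.
Variable R : realType.

(** Eliminating the derivative by the Appell property leaves a two-step recurrence between values,
    polynomial in [u] and [xi]. *)
Lemma horner_heat_polySS (u xi : R) k : (heat_poly u k.+2).[xi] =
  xi * (heat_poly u k.+1).[xi] + u * (k.+1%:R * (heat_poly u k).[xi]).
Proof.
rewrite [heat_poly u k.+2]/= -/(heat_poly u k.+1) hornerD hornerM hornerX hornerZ.
by rewrite deriv_heat_poly hornerZ.
Qed.

Lemma polyfun_heat_poly (I : finType) (u xi : (I -> R) -> R) k :
  polyfun u -> polyfun xi -> polyfun (fun x => (heat_poly (u x) k).[xi x]).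
Proof.
move=> pu pxi.
suff [] : polyfun (fun x => (heat_poly (u x) k).[xi x]) /\
          polyfun (fun x => (heat_poly (u x) k.+1).[xi x]) by [].
elim: k => [|k [IH0 IH1]].
  split; first by apply: eq_polyfun (polyfun_cst _ 1) => x; rewrite hornerC.
  by apply: eq_polyfun pxi => x; rewrite /= mulr1 derivC scaler0 addr0 hornerX.
split=> //.
apply: eq_polyfun
  (polyfunD (polyfunM pxi IH1) (polyfunM pu (polyfunM (polyfun_cst _ k.+1%:R) IH0))) => x.
by rewrite horner_heat_polySS.
Qed.

Lemma heat0 (p : {poly R}) : heat 0 p = p.
Proof.
elim/poly_ind: p => [|p c IH]; first by rewrite raddf0.
by rewrite mulrC raddfD/= heatC heat_mulX scale0r addr0 IH.
Qed.

Lemma size_heat (u : R) (p : {poly R}) : (size (heat u p) <= size p)%N.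
Proof.
rewrite /heat (leq_trans (size_sum _ _ _))//; apply/bigmax_leqP => i _.
by rewrite (leq_trans (size_scale_leq _ _))// (leq_trans (size_heat_poly _ _)).
Qed.

Definition unit_gauss_moments d : 'M[R]_d.+1 :=
  \matrix_(j < d.+1, i < d.+1) gaussE j%:R 1 'X^i.

(** A vector killed by the transpose is a polynomial of degree at most d whose image under [heat 1]
    vanishes at 0, ..., d. That image is then 0, and [heat (-1)] recovers the polynomial. *)
Lemma unit_gauss_moments_unit d : unit_gauss_moments d \in unitmx.
Proof.
rewrite -unitmx_tr -row_free_unit -kermx_eq0; apply/rowV0P => v /sub_kermxP vA.
have v_heat : heat 1 (rVpoly v) = 0.
  apply/eqP; apply: contraT => h0.
  have u : uniq [seq i%:R : R | i <- iota 0 d.+1].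
    by rewrite map_inj_uniq ?iota_uniq// => i j /eqP; rewrite eqr_nat => /eqP.
  have := max_poly_roots h0 _ u; rewrite size_map size_iota ltnNge.
  rewrite (leq_trans (size_heat _ _)) ?size_poly//; apply.
  apply/allP => _ /mapP[j + ->]; rewrite mem_iota/= add0n => jd; apply/eqP.
  have <- : (v *m (unit_gauss_moments d)^T) 0 (Ordinal jd) = (heat 1 (rVpoly v)).[j%:R].
    rewrite mxE (@heatE _ d.+1) ?size_poly// horner_sum; apply: eq_bigr => i _.
    by rewrite coef_rVpoly_ord hornerZ !mxE /gaussE heat_Xn.
  by rewrite vA mxE.
by apply: (can_inj (@rVpolyK _ _)); rewrite -[LHS]heat0 -(addNr 1) -heat_heat v_heat !raddf0.
Qed.

(* The parameters (i, 0), (i, 1), (i, 2) are the weight, the mean and the standard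
   deviation of the i-th component. *)
Definition param_moments d m (x : 'I_m * 'I_3 -> R) : 'rV[R]_d.+1 :=
  \row_(k < d.+1) \sum_(i < m)
    x (i, inord 0) * gaussE (x (i, inord 1)) (x (i, inord 2) ^+ 2) 'X^k.

(** Missing components are padded with weight 0, so one parameter space covers all representations
    with at most m components. *)
Lemma representable_param d m n (s : 'rV[R]_d.+1) : (n <= m)%N -> representable s n ->
  exists x : 'I_m * 'I_3 -> R, s = param_moments d x.
Proof.
move=> nm [c [xi [sigma [_ s0 ->]]]].
pose ext (g : 'I_n -> R) (i : nat) := if insub i is Some j then g j else 0.
have extE g (i : 'I_n) : ext g i = g i by rewrite /ext valK.
exists (fun ij : 'I_m * 'I_3 => nth 0 [:: ext c ij.1; ext xi ij.1; ext sigma ij.1] ij.2).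
apply/rowP => k; rewrite mixture_momentsE// mxE /= !inordK//=.
rewrite (eq_bigr (fun i : 'I_n => ext c i * gaussE (ext xi i) (ext sigma i ^+ 2) 'X^k)); last first.
  by move=> i _; rewrite !extE.
rewrite (big_ord_widen m (fun i => ext c i * gaussE (ext xi i) (ext sigma i ^+ 2) 'X^k)) //.
rewrite big_mkcond; apply: eq_bigr => i _; case: ltnP => // ni.
by rewrite {1}/ext insubF ?mul0r// ltnNge ni.
Qed.

Lemma polyfun_param_moments d m k : polyfun (fun x : 'I_m * 'I_3 -> R => param_moments d x 0 k).
Proof.
apply: (@eq_polyfun _ _ (fun x : 'I_m * 'I_3 -> R => \sum_(i < m)
    x (i, inord 0) * (heat_poly (x (i, inord 2) ^+ 2) k).[x (i, inord 1)])).
  by move=> x; rewrite mxE; apply: eq_bigr => i _; rewrite /gaussE heat_Xn.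
apply: polyfun_sum => i; apply: polyfunM; first exact: polyfun_var.
apply: polyfun_heat_poly; last exact: polyfun_var.
by apply: (@eq_polyfun _ _ (fun x => x (i, inord 2) * x (i, inord 2))) => //;
  exact: polyfunM (polyfun_var _ _) (polyfun_var _ _).
Qed.

Lemma cone_unit_gauss_moments d (a : 'rV[R]_d.+1) : (forall j, 0 <= a 0 j) ->
  mixture_moment_cone R d (a *m unit_gauss_moments d).
Proof.
move=> a0; exists (a 0), (fun j => j%:R), (fun=> 1); split=> [//|_|]; first exact: ltr01.
apply/rowP => k; rewrite mixture_momentsE; last by move=> _; exact: ltr01.
by rewrite mxE; apply: eq_bigr => j _; rewrite mxE expr1n.
Qed.

Lemma leq_mixture_caratheodory_number d : (d.+1 <= 3 * mixture_caratheodory_number R d)%N.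
Proof.
set C := mixture_caratheodory_number R d; rewrite leqNgt; apply/negP => Cd.
pose A := unit_gauss_moments d.
(* Coordinates in the basis of rows of A: the cone contains all points whose coordinates are
   nonnegative, so no polynomial relation between them can hold on it. *)
pose f j (x : 'I_C * 'I_3 -> R) := (param_moments d x *m invmx A) 0 j.
have pf j : polyfun (f j).
  apply: (@eq_polyfun _ _ (fun x => \sum_(i < d.+1) param_moments d x 0 i * invmx A i j)).
    by move=> x; rewrite /f mxE.
  by apply: polyfun_sum => i; apply: polyfunM; [exact: polyfun_param_moments|exact: polyfun_cst].
have [|N [c [[a ca] dep]]] := polyfun_algebraic_dependence _ pf.
  by rewrite card_prod !card_ord mulnC.
case/eqP: ca; apply: kronecker_curve_independent => y y0.
(* The Kronecker curve has nonnegative coordinates, so each of its points has at most C components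
   and must satisfy the relation. *)
pose w : 'rV[R]_d.+1 := \row_j y ^+ (N.+1 ^ j).
have wcone : mixture_moment_cone R d (w *m A).
  by apply: cone_unit_gauss_moments => j; rewrite mxE exprn_ge0.
have [rep _] := mixture_numberP wcone.
have numC : (mixture_number (w *m A) <= C)%N.
  have [_ ub] := mixture_caratheodory_numberP R d.
  by rewrite -leEnat; apply: ub; exists (w *m A).
have [x sx] := representable_param numC rep.
apply: etrans (dep x); apply: eq_bigr => b _; congr (_ * _); apply: eq_bigr => j _.
by rewrite /f -sx mulmxK ?unit_gauss_moments_unit// mxE.
Qed.

End LowerBound.

Theorem corollary35 (R : realType) (d : nat) :
  (is_maximum (mixture_numbers R d) (mixture_caratheodory_number R d) /\
   Num.ceil (d.+1%:R / 3 : R) <= (mixture_caratheodory_number R d)%:Z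
     <= Num.ceil (d.+1%:R / 2 : R))
  /\
  (forall s : 'rV[R]_d.+1, (exists n : nat, representable s n) ->
     exists (k : nat) (sigma : R) (c x : 'I_k -> R),
       [/\ k%:Z <= Num.ceil (d.+1%:R / 2 : R),
           0 < sigma,
           forall i, 0 < c i
         & s = \sum_(i < k) c i *: gauss_moments d (x i) sigma])
  /\
  (forall s : 'rV[R]_d.+1, (exists n : nat, representable s n) ->
     exists (k : nat) (sigma : R) (c x : 'I_k -> R),
       [/\ k%:Z <= Num.ceil (d.+1%:R / 2 : R),
           0 < sigma,
           forall i, 0 < c i
         & exists w : 'I_k -> R,
             mixture_representation s w x (fun=> sigma) /\
             has_lebesgue_density (gaussian_mixture w x (fun=> sigma))
               (fun y => \sum_(i < k)
                  c i * expR (- ((y - x i) ^+ 2 / (2 * sigma ^+ 2))))]).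
Proof.
split; first split.
- exact: mixture_caratheodory_numberP.
- apply/andP; split.
    rewrite ceil_le_int ler_pdivrMr ?ltr0n// -pmulrn -natrM ler_nat mulnC.
    exact: leq_mixture_caratheodory_number.
  apply: le_ceil_half.
  have [[s sc <-] _] := mixture_caratheodory_numberP R d.
  exact: mixture_number_le.
split=> s [n] /equal_variance_representation[k [sigma [w [x [kd s0 rep]]]]].
- exists k, sigma, w, x; split; [exact: le_ceil_half|exact: s0| |].
    by case: rep.
  by have [_ _ ->] := rep.
(* The coefficients of the density absorb the normalising factor of the Gaussians. *)
- exists k, sigma, (fun i => w i * normal_peak sigma), x.
  split; [exact: le_ceil_half|exact: s0| |].
    by case: rep => w0 _ _ i; rewrite mulr_gt0// normal_peak_gt0// gt_eqF.
  by exists w; split; [exact: rep|exact: gaussian_mixture_density].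
Qed.
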